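(* Linear attention with a linearized relative positional encoding can be computed in $O(nd^2)$ time. Precisely: there are an absolute constant $C$ and an algorithm such that for all integers $n,d\ge 1$, given matrices $\mathbf M_1,\ldots,\mathbf M_n\in\mathbb C^{d\times d}$ and $\mathbf Q,\mathbf K,\mathbf V\in\mathbb C^{n\times d}$ with $s$-th rows $\mathbf q_s^{\mathsf H},\mathbf k_s^{\mathsf H},\mathbf v_s^{\mathsf H}$ respectively, and such that the diagonal matrix $\mathbf\Delta$ below is invertible, the algorithm computes $$\mathbf O=\mathbf\Delta^{-1}\tilde{\mathbf Q}\tilde{\mathbf K}^{\mathsf H}\mathbf V\in\mathbb C^{n\times d},\qquad \mathbf\Delta=\mathrm{diag}\bigl(\tilde{\mathbf Q}\,[\tilde{\mathbf K}^{\mathsf H}\mathbf 1_n]\bigr)\in\mathbb C^{n\times n},$$ using at most $C\,nd^2$ arithmetic operations on complex numbers, where $\tilde{\mathbf Q},\tilde{\mathbf K}\in\mathbb C^{n\times d}$ are the matrices whose $s$-th rows are $(\mathbf M_s\mathbf q_s)^{\mathsf H}$ and $(\mathbf M_s\mathbf k_s)^{\mathsf H}$ respectively.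
   Context: $\mathsf H$ denotes conjugate transposition, $\mathbf 1_n$ is the all-ones column vector of length $n$, and $\mathrm{diag}(\mathbf u)$ is the diagonal matrix with the entries of the vector $\mathbf u$ on the diagonal. Here $n$ is the sequence length and $d$ the embedding dimension. A linearized relative positional encoding is an encoding $f_{\mathrm{rel}}(\mathbf q_s,\mathbf k_t)=\mathbf q_s^{\mathsf H}\mathbf W_{t-s}\mathbf k_t$ (with $\mathbf W_0=\mathbf I_d$) that decomposes as $(\mathbf M_s\mathbf q_s)^{\mathsf H}(\mathbf M_t\mathbf k_t)$; the $(s,t)$ entry of $\tilde{\mathbf Q}\tilde{\mathbf K}^{\mathsf H}$ is this quantity. Arithmetic operations are additions, subtractions, multiplications, divisions and conjugations of complex numbers, each counted as one operation. *)

(* Defs.v *)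
From HB Require Import structures.
From mathcomp Require Import all_boot all_order all_algebra all_reals complex.
Set Implicit Arguments.
Unset Strict Implicit.
Unset Printing Implicit Defensive.
Import Order.TTheory GRing.Theory Num.Theory.
Local Open Scope ring_scope.
Local Open Scope sesquilinear_scope.

Section Attention.
Variables (F : numClosedFieldType) (n d : nat).
Implicit Types (M : 'I_n -> 'M[F]_d) (X Q K V : 'M[F]_(n, d)).

(* The s-th row of X is x_s^H, so x_s is the conjugate transpose of that row;
   the s-th row of the result is (M_s x_s)^H. *)
Definition encode M X : 'M[F]_(n, d) :=
  \matrix_(s < n) (M s *m (row s X)^t*)^t*.

(* diag_mx takes a row vector, hence the (plain) transpose. *)
Definition attn_delta M Q K : 'M[F]_n :=
  diag_mx (encode M Q *m ((encode M K)^t* *m (const_mx 1 : 'cV[F]_n)))^T.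

Definition lin_attention M Q K V : 'M[F]_(n, d) :=
  invmx (attn_delta M Q K) *m encode M Q *m (encode M K)^t* *m V.

End Attention.

(* An algorithm is one finite program, independent of the sizes. Its memory
   consists of arrays of field elements; the cell named (a, idx) is the entry
   of multi-index idx of array number a. Control flow and indices depend only
   on natural numbers, never on field elements. *)

Inductive iexp : Type :=
  | IVar of nat
  | ILit of nat
  | IAdd of iexp & iexp
  | ISub of iexp & iexp
  | IMul of iexp & iexp.

Fixpoint ieval (rho : nat -> nat) (e : iexp) : nat :=
  match e with
  | IVar x => rho x
  | ILit k => k
  | IAdd e1 e2 => (ieval rho e1 + ieval rho e2)%N
  | ISub e1 e2 => (ieval rho e1 - ieval rho e2)%N
  | IMul e1 e2 => (ieval rho e1 * ieval rho e2)%N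
  end.

Definition bind_var (rho : nat -> nat) (x k : nat) : nat -> nat :=
  fun y => if y == x then k else rho y.

Definition loc : Type := (nat * seq iexp)%type.

Definition cell : Type := (nat * seq nat)%type.

Definition leval (rho : nat -> nat) (l : loc) : cell :=
  (l.1, [seq ieval rho e | e <- l.2]).

Inductive binop : Type := OpAdd | OpSub | OpMul | OpDiv.

(* Const l b stores 0 or 1 in l, at no cost; Bin o l x y performs l := x o y;
   Conj l x stores in l the conjugate of x; For x e c runs c for x = 0, ..., e - 1. *)
Inductive prog : Type :=
  | Skip
  | Seq of prog & prog
  | Const of loc & bool
  | Bin of binop & loc & loc & loc
  | Conj of loc & loc
  | For of nat & iexp & prog.

Section Execution.
Variable F : numClosedFieldType.

Definition store : Type := cell -> F.

Definition update (sg : store) (l : cell) (z : F) : store :=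
  fun l' => if l' == l then z else sg l'.

(* Division by zero is a run-time error, not the library's x / 0 = 0. *)
Definition bin_eval (o : binop) (x y : F) : option F :=
  match o with
  | OpAdd => Some (x + y)
  | OpSub => Some (x - y)
  | OpMul => Some (x * y)
  | OpDiv => if y == 0 then None else Some (x / y)
  end.

(* A state pairs the memory with the number of arithmetic operations performed
   so far; None means that an error occurred. *)
Definition state : Type := (store * nat)%type.

Fixpoint exec (rho : nat -> nat) (c : prog) (st : state) : option state :=
  match c with
  | Skip => Some st
  | Seq c1 c2 => obind (exec rho c2) (exec rho c1 st)
  | Const l b => Some (update st.1 (leval rho l) b%:R, st.2)
  | Bin o l x y =>
      omap (fun z => (update st.1 (leval rho l) z, st.2.+1))
        (bin_eval o (st.1 (leval rho x)) (st.1 (leval rho y)))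
  | Conj l x =>
      Some (update st.1 (leval rho l) (Num.conj (st.1 (leval rho x))), st.2.+1)
  | For x e c' =>
      iteri (ieval rho e) (fun k => obind (exec (bind_var rho x k) c')) (Some st)
  end.

Definition stores_mx m n (sg : store) (a : nat) (A : 'M[F]_(m, n)) : Prop :=
  forall (i : 'I_m) (j : 'I_n), sg (a, [:: i : nat; j : nat]) = A i j.

(* Input: M, Q, K, V in arrays 0, 1, 2, 3. All other cells are unconstrained,
   so a program cannot rely on their initial contents. *)
Definition stores_input n d (sg : store) (M : 'I_n -> 'M[F]_d)
    (Q K V : 'M[F]_(n, d)) : Prop :=
  [/\ forall (s : 'I_n) (i j : 'I_d),
        sg (0%N, [:: s : nat; i : nat; j : nat]) = M s i j,
      stores_mx sg 1 Q, stores_mx sg 2 K & stores_mx sg 3 V].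

(* Output: array 4. *)
Definition stores_output n d (sg : store) (O : 'M[F]_(n, d)) : Prop :=
  stores_mx sg 4 O.

End Execution.

(* The sizes n and d are the initial values of the index variables 0 and 1. *)
Definition init_env (n d : nat) : nat -> nat := nth 0%N [:: n; d].

(* Main.v *)
Require Import Defs.
From HB Require Import structures.
From mathcomp Require Import all_boot all_order all_algebra all_reals complex.
From mathcomp Require Import zify.
Set Implicit Arguments.
Unset Strict Implicit.
Unset Printing Implicit Defensive.
Import Order.TTheory GRing.Theory Num.Theory.
Local Open Scope ring_scope.
Local Open Scope complex_scope.

(** By associativity, [O = Delta^-1 (Qt (Kt^H V))], where [Kt^H V] is only d x d,
    and [Delta] has the diagonal [Qt (Kt^H 1)].  All the sums involved take the
    form [sum_k a_k * conj b_k], provided that one computes the conjugates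
    [conj (Kt^H V)] and [conj (Kt^H 1)] in place of the matrices themselves:
    [Qt s j = sum_i Q s i * conj (M_s j i)] and likewise for [Kt],
    [conj (Kt^H V) j l = sum_s Kt s j * conj (V s l)], and so on.  Hence a single
    triple loop, used six times, and n * d divisions suffice. *)

(** * Correctness and operation counts of loops *)

Section Programs.
Variable F : numClosedFieldType.
Implicit Types (rho : nat -> nat) (sg : store F) (st : state F) (l : cell).

(** The loop rule for total correctness: [I k] is the invariant after [k] iterations, and the
    existence of a final state records that no division by zero occurred. *)
Lemma exec_for (I : nat -> state F -> Prop) rho x e c st :
    I 0%N st ->
    (forall k st1, (k < ieval rho e)%N -> I k st1 ->
      exists2 st2, exec (bind_var rho x k) c st1 = Some st2 & I k.+1 st2) ->
  exists2 st', exec rho (For x e c) st = Some st' & I (ieval rho e) st'.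
Proof.
move=> I0 IS /=; elim: (ieval rho e) IS => [|m IHm] IS; first by exists st.
have [k st1 ltkm|st1 E1 I1] := IHm; first by apply: IS; rewrite ltnW.
by have [//|st2 E2 I2] := IS m st1 _ I1; exists st2; rewrite //= E1.
Qed.

Definition scratch : nat := 5.

Definition dot_step (dest a b : loc) : prog :=
  Seq (Conj (scratch, [::]) b)
  (Seq (Bin OpMul (scratch, [::]) a (scratch, [::]))
       (Bin OpAdd dest dest (scratch, [::]))).

Definition dot (dest : loc) (x : nat) (e : iexp) (a b : loc) : prog :=
  Seq (Const dest false) (For x e (dot_step dest a b)).

(** The whole scratch array is exempt from the frame condition, since intermediate values are left
    there. *)
Definition upd_at sg sg' l (z : F) : Prop :=
  sg' l = z /\ forall l', l'.1 <> scratch -> l' <> l -> sg' l' = sg l'.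

Lemma update_eq sg l z : update sg l z l = z.
Proof. by rewrite /update eqxx. Qed.

Lemma update_neq sg l z l' : l' <> l -> update sg l z l' = sg l'.
Proof. by rewrite /update; case: eqP. Qed.

(** Each term costs a conjugation, a product and an addition. The accumulator stays at one cell
    because its address does not depend on [x], and the operands keep their initial values because
    their arrays are never written. *)
Lemma exec_dot rho (dest : loc) x e (a b : loc) sg t :
    dest.1 <> scratch ->
    (forall k, leval (bind_var rho x k) dest = leval rho dest) ->
    a.1 <> scratch -> a.1 <> dest.1 -> b.1 <> scratch -> b.1 <> dest.1 ->
  exists sg', exec rho (dot dest x e a b) (sg, t) =
      Some (sg', (t + 3 * ieval rho e)%N) /\
    upd_at sg sg' (leval rho dest)
      (\sum_(k < ieval rho e) sg (leval (bind_var rho x k) a) *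
                  Num.conj (sg (leval (bind_var rho x k) b))).
Proof.
move=> dS dx aS ad bS bd.
have nd (c1 : loc) rho1 : c1.1 <> dest.1 -> leval rho1 c1 <> leval rho dest.
  by move=> ne [].
have nS (c1 : loc) rho1 : c1.1 <> scratch -> leval rho1 c1 <> (scratch, [::]).
  by move=> ne [].
pose term k := sg (leval (bind_var rho x k) a) *
               Num.conj (sg (leval (bind_var rho x k) b)).
pose I k (st : state F) := st.2 = (t + 3 * k)%N /\
  upd_at sg st.1 (leval rho dest) (\sum_(i < k) term i).
set st0 : state F := (update sg (leval rho dest) 0, t).
have [||[sg' t'] E [/= Et H]] :=
    @exec_for I rho x e (dot_step dest a b) st0.
- split; first by rewrite muln0 addn0.
  by split=> [|l' _ ne] /=; rewrite ?big_ord0 ?update_eq ?update_neq.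
- move=> k [sg1 t1] _ [/= -> [H1 H2]]; eexists; first by [].
  rewrite /= dx; split; first by rewrite /=; lia.
  split=> /= [|l' l'S l'd].
    rewrite update_eq big_ord_recr /= -H1 !update_eq.
    (* The two writes to the scratch cell leave the accumulator intact. *)
    rewrite [in X in X + _ = _]update_neq; last exact: nS.
    rewrite [in X in X + _ = _]update_neq; last exact: nS.
    congr (_ + _); rewrite [update _ _ _ (leval _ a)]update_neq; last exact: nS.
    by rewrite !H2 //; apply: nd.
  by rewrite !update_neq ?H2 // => El; rewrite El in l'S.
- by exists sg'; rewrite -Et.
Qed.

(** Index variables 0 and 1 are reserved for the sizes [n] and [d]. *)
Definition table (e1 e2 : iexp) (c : prog) : prog := For 2 e1 (For 3 e2 c).

(** The body may assume that everything outside scratch and array [a] is as in [sg]; this makes [f]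
    independent of the entries already filled in. *)
Lemma exec_table rho e1 e2 c (a cost : nat) (f : nat -> nat -> F) sg t :
    a <> scratch ->
    (forall k, ieval (bind_var rho 2 k) e2 = ieval rho e2) ->
    (forall i j sg1 t1, (i < ieval rho e1)%N -> (j < ieval rho e2)%N ->
      (forall l, l.1 <> scratch -> l.1 <> a -> sg1 l = sg l) ->
      exists sg2,
        exec (bind_var (bind_var rho 2 i) 3 j) c (sg1, t1) =
          Some (sg2, (t1 + cost)%N) /\
        upd_at sg1 sg2 (a, [:: i; j]) (f i j)) ->
  exists sg', [/\ exec rho (table e1 e2 c) (sg, t) =
      Some (sg', (t + ieval rho e1 * (ieval rho e2 * cost))%N),
    forall i j, (i < ieval rho e1)%N -> (j < ieval rho e2)%N ->
      sg' (a, [:: i; j]) = f i j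
    & forall l, l.1 <> scratch -> l.1 <> a -> sg' l = sg l].
Proof.
move=> aS e2x body; set m1 := ieval rho e1; set m2 := ieval rho e2.
(* Invariant after [i] complete rows and [j] entries of row [i], in lexicographic order. *)
pose I i j (st : state F) :=
  [/\ st.2 = (t + (i * m2 + j) * cost)%N,
    forall i' j', (i' < i)%N && (j' < m2)%N || (i' == i) && (j' < j)%N ->
      st.1 (a, [:: i'; j']) = f i' j'
    & forall l, l.1 <> scratch -> l.1 <> a -> st.1 l = sg l].
have inner i st1 : (i < m1)%N -> I i 0%N st1 ->
    exists2 st2, exec (bind_var rho 2 i) (For 3 e2 c) st1 = Some st2
      & I i m2 st2.
  move=> lti I1.
  have [|j [sg1 t1]|st2 E2 H2] := @exec_for (I i) (bind_var rho 2 i) 3 e2 c st1.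
  - by [].
  - rewrite e2x -/m2 => ltj [/= -> If Ig].
    have [sg2 [E2 [H2 G2]]] := body i j sg1 (t + (i * m2 + j) * cost)%N lti ltj Ig.
    eexists; first exact: E2.
    split=> /= [|i' j' lt'|l lS la]; first by lia.
    + have [[-> ->]|ne] : (i', j') = (i, j) \/ (i', j') <> (i, j).
        by case: (eqVneq (i', j') (i, j)) => [|/eqP]; [left | right].
      * exact: H2.
      * rewrite G2 //; last by case=> Ei Ej; apply: ne; rewrite Ei Ej.
        apply: If; apply: contra_notT ne => lt0; congr (_, _); lia.
    + by rewrite G2 ?Ig // => El; apply: la; rewrite El.
  by rewrite e2x -/m2 in H2; exists st2.
have [||[sg' t'] E [/= Et H G]] :=
    @exec_for (fun i => I i 0%N) rho 2 e1 (For 3 e2 c) (sg, t).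
- by split=> //= *; lia.
(* A full row is the start of the next one: [I i m2] gives [I i.+1 0]. *)
- move=> i st1 lti /(inner i _ lti)[st2 E2 [Et If Ig]]; exists st2 => //.
  by split=> // [|i' j' lt']; [lia | apply: If; lia].
exists sg'; split=> // [|i j lti ltj]; last by apply: H; rewrite lti ltj.
by apply: etrans E _; rewrite Et -/m1 mulnA addn0.
Qed.

Definition dot_table (dest : nat) (e1 e2 e3 : iexp) (a b : loc) : prog :=
  table e1 e2 (dot (dest, [:: IVar 2; IVar 3]) 4 e3 a b).

Lemma exec_dot_table rho dest e1 e2 e3 (a b : loc) sg t :
    (forall k, ieval (bind_var rho 2 k) e2 = ieval rho e2) ->
    (forall i j, ieval (bind_var (bind_var rho 2 i) 3 j) e3 = ieval rho e3) ->
    [&& dest != scratch, a.1 != scratch, a.1 != dest, b.1 != scratch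
      & b.1 != dest] ->
  let env i j k := bind_var (bind_var (bind_var rho 2 i) 3 j) 4 k in
  exists sg', [/\ exec rho (dot_table dest e1 e2 e3 a b) (sg, t) =
      Some (sg', (t + 3 * (ieval rho e1 * ieval rho e2 * ieval rho e3))%N),
    forall i j, (i < ieval rho e1)%N -> (j < ieval rho e2)%N ->
      sg' (dest, [:: i; j]) =
        \sum_(k < ieval rho e3) sg (leval (env i j k) a) *
                                Num.conj (sg (leval (env i j k) b))
    & forall l, l.1 <> scratch -> l.1 <> dest -> sg' l = sg l].
Proof.
move=> e2x e3x /and5P[/eqP dS /eqP aS /eqP ad /eqP bS /eqP bd] env.
have [||i j sg1 t1 lti ltj G1|sg' [E H G]] := @exec_table rho e1 e2
   (dot (dest, [:: IVar 2; IVar 3]) 4 e3 a b) dest (3 * ieval rho e3)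
   (fun i j => \sum_(k < ieval rho e3) sg (leval (env i j k) a) *
                                Num.conj (sg (leval (env i j k) b))) sg t.
- exact: dS.
- exact: e2x.
- have [||||||sg2 [E2 H2]] := @exec_dot (bind_var (bind_var rho 2 i) 3 j)
    (dest, [:: IVar 2; IVar 3]) 4 e3 a b sg1 t1 => //.
  exists sg2; rewrite E2 e3x; split=> //.
  rewrite e3x in H2; congr upd_at: H2; apply: eq_bigr => k _.
  by rewrite !G1.
- exists sg'; split=> //; by apply: etrans E _; congr (Some (_, _)); lia.
Qed.

Lemma exec_seq rho c1 c2 st st1 (P : state F -> Prop) :
    exec rho c1 st = Some st1 ->
    (exists2 st', exec rho c2 st1 = Some st' & P st') ->
  exists2 st', exec rho (Seq c1 c2) st = Some st' & P st'.
Proof. by move=> E1 [st' E2 P']; exists st'; rewrite //= E1. Qed.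

(** Continuation form: the remaining program [c] starts from a store known only through its new
    table and its frame condition, so a chain of tables is processed by one application each. *)
Lemma exec_seq_dot_table rho dest e1 e2 e3 (a b : loc) c sg t
    (P : state F -> Prop) :
    (forall k, ieval (bind_var rho 2 k) e2 = ieval rho e2) ->
    (forall i j, ieval (bind_var (bind_var rho 2 i) 3 j) e3 = ieval rho e3) ->
    [&& dest != scratch, a.1 != scratch, a.1 != dest, b.1 != scratch
      & b.1 != dest] ->
    let env i j k := bind_var (bind_var (bind_var rho 2 i) 3 j) 4 k in
    (forall sg1,
      (forall i j, (i < ieval rho e1)%N -> (j < ieval rho e2)%N ->
        sg1 (dest, [:: i; j]) =
          \sum_(k < ieval rho e3) sg (leval (env i j k) a) *
                                  Num.conj (sg (leval (env i j k) b))) ->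
      (forall l, l.1 <> scratch -> l.1 <> dest -> sg1 l = sg l) ->
      exists2 st', exec rho c
        (sg1, (t + 3 * (ieval rho e1 * ieval rho e2 * ieval rho e3))%N) =
          Some st' & P st') ->
  exists2 st', exec rho (Seq (dot_table dest e1 e2 e3 a b) c) (sg, t) = Some st'
    & P st'.
Proof.
move=> e2x e3x ne env Pc.
have [sg1 [E1 H1 G1]] := @exec_dot_table rho dest e1 e2 e3 a b sg t e2x e3x ne.
by apply: exec_seq E1 _; apply: Pc.
Qed.

End Programs.

(** * Entrywise formulas for attention *)

Section AttentionEntries.
Local Open Scope sesquilinear_scope.
Variables (F : numClosedFieldType) (n d : nat).
Implicit Types (M : 'I_n -> 'M[F]_d) (X Q K V : 'M[F]_(n, d)).

Lemma encodeE M X s j :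
  encode M X s j = \sum_(i < d) X s i * Num.conj (M s j i).
Proof.
rewrite !mxE rmorph_sum; apply: eq_bigr => i _.
by rewrite rmorphM /= !mxE conjCK mulrC.
Qed.

(** Conjugating an entry of [B^t* *m C] moves the conjugation from [B] to [C], so both nested sums
    have the shape computed by [dot]. *)
Lemma mulmx_conjE m p (A : 'M[F]_(n, d)) (B : 'M[F]_(m, d)) (C : 'M[F]_(m, p))
    s l :
  (A *m (B^t* *m C)) s l =
  \sum_(j < d) A s j * Num.conj (\sum_(t < m) B t j * Num.conj (C t l)).
Proof.
rewrite mxE; apply: eq_bigr => j _; congr (_ * _).
rewrite mxE rmorph_sum; apply: eq_bigr => t _.
by rewrite rmorphM /= conjCK !mxE.
Qed.

(** A diagonal entry of Delta; [Num.conj 1] is kept unsimplified to match what [dot] computes. *)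
Definition attn_weight M Q K (s : 'I_n) : F :=
  \sum_(j < d) encode M Q s j *
    Num.conj (\sum_(t < n) encode M K t j * Num.conj 1).

Lemma attn_deltaE M Q K : attn_delta M Q K = diag_mx (\row_s attn_weight M Q K s).
Proof.
congr diag_mx; apply/rowP => s; rewrite [RHS]mxE mxE mulmx_conjE.
apply: eq_bigr => j _; congr (_ * Num.conj _).
by apply: eq_bigr => t _; rewrite [const_mx _ _ _]mxE.
Qed.

Lemma attn_weight_neq0 M Q K s :
  attn_delta M Q K \in unitmx -> attn_weight M Q K s != 0.
Proof.
rewrite attn_deltaE unitmxE det_diag unitfE => /prodf_neq0 /(_ s isT).
by rewrite mxE.
Qed.

(** Multiplying by Delta cancels the inverse matrix; row [s] is then divided by its nonzero
    weight. *)
Lemma lin_attentionE M Q K V s l :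
  attn_delta M Q K \in unitmx ->
  lin_attention M Q K V s l =
  (\sum_(j < d) encode M Q s j *
     Num.conj (\sum_(t < n) encode M K t j * Num.conj (V t l))) /
  attn_weight M Q K s.
Proof.
move=> uD; have w0 := attn_weight_neq0 s uD.
have /matrixP/(_ s l) : attn_delta M Q K *m lin_attention M Q K V =
    encode M Q *m ((encode M K)^t* *m V).
  by rewrite /lin_attention -!mulmxA mulKVmx.
rewrite mulmx_conjE attn_deltaE mul_diag_mx mxE mxE => <-.
by rewrite mulrAC mulfV // mul1r.
Qed.

End AttentionEntries.

(** * The algorithm and its cost *)

(* Arrays: 6 holds the constant 1, 7 = Qt, 8 = Kt, 9 = conj (Kt^H V) and
   10 = conj (Kt^H 1), 11 = Qt Kt^H V, 12 = the diagonal of Delta. *)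
Definition attention_prog : prog :=
  let: (i, j, k) := (IVar 2, IVar 3, IVar 4) in
  let: (n, d) := (IVar 0, IVar 1) in
  Seq (Const (6, [::]) true)
  (Seq (dot_table 7 n d d (1, [:: i; k]) (0, [:: i; j; k]))
  (Seq (dot_table 8 n d d (2, [:: i; k]) (0, [:: i; j; k]))
  (Seq (dot_table 9 d d n (8, [:: k; i]) (3, [:: k; j]))
  (Seq (dot_table 10 d (ILit 1) n (8, [:: k; i]) (6, [::]))
  (Seq (dot_table 11 n d d (7, [:: i; k]) (9, [:: k; j]))
  (Seq (dot_table 12 n (ILit 1) d (7, [:: i; k]) (10, [:: k; ILit 0]))
  (table n d (Bin OpDiv (4, [:: i; j]) (11, [:: i; j]) (12, [:: i; ILit 0])))))))))%N.

Theorem mainTheorem5 :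
  exists (C : nat) (p : prog),
  forall (R : realType) (n d : nat), (1 <= n)%N -> (1 <= d)%N ->
  forall (M : 'I_n -> 'M[R[i]]_d) (Q K V : 'M[R[i]]_(n, d)),
  attn_delta M Q K \in unitmx ->
  forall sg : store R[i], stores_input sg M Q K V ->
  exists (sg' : store R[i]) (ops : nat),
    [/\ exec (init_env n d) p (sg, 0%N) = Some (sg', ops),
        stores_output sg' (lin_attention M Q K V)
      & (ops <= C * (n * d ^ 2))%N].
Proof.
(* Four tables cost [3 * n * d ^ 2] each, two cost [3 * n * d] each, and there are [n * d]
   divisions; as [d >= 1], the total [12 * n * d ^ 2 + 7 * n * d] is at most [19 * n * d ^ 2]. *)
exists 19%N, attention_prog => R n d n1 d1 M Q K V uD sg [inM inQ inK inV].
suff [[sg' ops] E [HO Hops]] : exists2 st' : state R[i],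
    exec (init_env n d) attention_prog (sg, 0%N) = Some st' &
    stores_output st'.1 (lin_attention M Q K V) /\
      (st'.2 <= 19 * (n * d ^ 2))%N.
  by exists sg', ops.
rewrite /attention_prog; pose sg0 := update sg (6%N, [::]) 1.
apply: (@exec_seq _ _ _ _ _ (sg0, 0%N)); first by [].
have G0 l : l.1 <> 6%N -> sg0 l = sg l.
  by move=> l6; apply: update_neq => El; apply: l6; rewrite El.
apply: exec_seq_dot_table => // sg1 H1 G1.
apply: exec_seq_dot_table => // sg2 H2 G2.
apply: exec_seq_dot_table => // sg3 H3 G3.
apply: exec_seq_dot_table => // sg4 H4 G4.
apply: exec_seq_dot_table => // sg5 H5 G5.
apply: exec_seq_dot_table => // sg6 H6 G6.
rewrite /leval /= /bind_var /= in H1 H2 H3 H4 H5 H6.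
rewrite /init_env /= in H1 H2 H3 H4 H5 H6.
(* The [H] facts give each new table, and the [G] facts carry older arrays through later stores. *)
have out (s : 'I_n) (l : 'I_d) : sg6 (11%N, [:: s : nat; l : nat]) / sg6 (12%N, [:: s : nat; 0%N]) =
    lin_attention M Q K V s l /\ sg6 (12%N, [:: s : nat; 0%N]) != 0.
  have QtE (s' : 'I_n) (j : 'I_d) : sg1 (7%N, [:: s' : nat; j : nat]) = encode M Q s' j.
    by rewrite encodeE H1 //; apply: eq_bigr => k _; rewrite !G0 // inQ inM.
  have KtE (s' : 'I_n) (j : 'I_d) : sg2 (8%N, [:: s' : nat; j : nat]) = encode M K s' j.
    rewrite encodeE H2 //; apply: eq_bigr => k _.
    by rewrite !G1 // !G0 // inK inM.
  have KVE (j l' : 'I_d) : sg3 (9%N, [:: j : nat; l' : nat]) =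
      \sum_(t < n) encode M K t j * Num.conj (V t l').
    by rewrite H3 //; apply: eq_bigr => t _; rewrite KtE G2 // G1 // G0 // inV.
  have K1E (j : 'I_d) : sg4 (10%N, [:: j : nat; 0%N]) =
      \sum_(t < n) encode M K t j * Num.conj 1.
    rewrite H4 //; apply: eq_bigr => t _.
    by rewrite G3 // KtE G3 // G2 // G1 // update_eq.
  have wE : sg6 (12%N, [:: s : nat; 0%N]) = attn_weight M Q K s.
    rewrite H6 //; apply: eq_bigr => j _.
    by rewrite G5 // G4 // G3 // G2 // QtE G5 // K1E.
  rewrite wE attn_weight_neq0 // lin_attentionE //; split=> //; congr (_ / _).
  rewrite G6 // H5 //; apply: eq_bigr => j _.
  by rewrite G4 // G3 // G2 // QtE G4 // KVE.
set t0 := (X in exec _ _ (sg6, X)).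
have [//|//|i j sgi t lti ltj Gi|sg' [E H _]] := @exec_table _ (init_env n d)
    (IVar 0) (IVar 1) (Bin OpDiv (4%N, [:: IVar 2; IVar 3])
       (11%N, [:: IVar 2; IVar 3]) (12%N, [:: IVar 2; ILit 0])) 4%N 1%N
    (fun i j => sg6 (11%N, [:: i; j]) / sg6 (12%N, [:: i; 0%N])) sg6 t0.
(* Invertibility of Delta enters here: the divisor is nonzero, so the division raises no error. *)
- have [_ w0] := out (Ordinal lti) (Ordinal ltj).
  eexists; split.
    rewrite /= /leval /= /bind_var /= !Gi //= (negPf w0) /=.
    by rewrite addn1.
  split=> [|l lS l4]; first exact: update_eq.
  exact: update_neq.
- eexists; first exact: E.
  split=> [s l|]; first by rewrite /= H //; case: (out s l).
  by rewrite /t0 /= /init_env /=; nia.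
Qed.
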